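(* Let $\overline{n}\in\mathbb{N}$ and $\epsilon>0$. Assume that $\phi_0/\pi$ and $(\theta_0/\pi)^2$ are irrational numbers, and take $\phi_R=\pi/2-\overline{n}\,\phi_0$. Consider the closed-loop Markov process $(\rho_k)_{k\in\mathbb{N}}$ on $\mathbb{D}_*$ described in the context, with control $u_k=f(\rho_k)$, where $f$ is the feedback law described in the context (for these $\overline{n}$ and $\epsilon$). Then, for any initial condition $\rho_0\in\mathbb{D}_*$, $\rho_k$ converges almost surely towards $\overline{\rho}=|\overline{n}\rangle\langle\overline{n}|$ as $k\to\infty$, in the sense that, almost surely, $\lim_{k\to\infty}\langle n|\rho_k|n\rangle=\langle n|\overline{\rho}|n\rangle$ for every $n\in\mathbb{N}$ (i.e. the limit is $1$ for $n=\overline{n}$ and $0$ for $n\neq\overline{n}$).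
   Context: $\mathbb{N}=\{0,1,2,\dots\}$. $\mathcal{H}$ is a separable complex Hilbert space with orthonormal basis $\{|n\rangle: n\in\mathbb{N}\}$ (Fock states). $\mathbb{D}$ is the set of density operators on $\mathcal{H}$ (trace-class, self-adjoint, non-negative operators with unit trace). For an operator $A$ on $\mathcal{H}$, $A_{mn}=\langle m|A|n\rangle$. For $n^*\in\mathbb{N}$, $\mathbb{D}_{n^*}=\{\rho\in\mathbb{D}: \rho|n\rangle=0 \text{ for all } n>n^*\}$, and $\mathbb{D}_*=\bigcup_{n^*\in\mathbb{N}}\mathbb{D}_{n^*}$. Measurement operators. Given real parameters $\phi_0,\phi_R,\theta_0$, define bounded operators $M_g(u),M_e(u)$ on $\mathcal{H}$, $u\in\{-1,0,1\}$, by their action on the basis ($n\in\mathbb{N}$): $M_g(0)|n\rangle=\cos\left(\frac{\phi_0 n+\phi_R}{2}\right)|n\rangle$, $M_e(0)|n\rangle=\sin\left(\frac{\phi_0 n+\phi_R}{2}\right)|n\rangle$; $M_g(+1)|n\rangle=\sin\left(\frac{\theta_0}{2}\sqrt{n+1}\right)|n+1\rangle$, $M_e(+1)|n\rangle=\cos\left(\frac{\theta_0}{2}\sqrt{n+1}\right)|n\rangle$; $M_g(-1)|n\rangle=\cos\left(\frac{\theta_0}{2}\sqrt{n}\right)|n\rangle$, $M_e(-1)|n\rangle=\sin\left(\frac{\theta_0}{2}\sqrt{n}\right)|n-1\rangle$ for $n\ge1$, and $M_e(-1)|0\rangle=0$. They satisfy $M_g(u)^\dagger M_g(u)+M_e(u)^\dagger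 M_e(u)=I$. Markov process. Given the state $\rho_k$ and the control $u_k\in\{-1,0,1\}$, the outcome $y_k\in\{g,e\}$ equals $y$ with probability $p_{y,k}=\mathrm{Tr}\left(M_y(u_k)\rho_kM_y(u_k)^\dagger\right)$, and then $\rho_{k+1}=M_y(u_k)\rho_kM_y(u_k)^\dagger/p_{y,k}$. An outcome of probability $0$ never occurs and contributes $0$ to expectations. Feedback law. Let $d(n)=(n-\overline{n})^2$ and, for $\rho\in\mathbb{D}_*$, $V_\epsilon(\rho)=\mathrm{Tr}(d(N)\rho)-\epsilon\sum_{n\in\mathbb{N}}\rho_{nn}^2$, where $N|n\rangle=n|n\rangle$; thus $\mathrm{Tr}(d(N)\rho)=\sum_n\rho_{nn}(n-\overline{n})^2$ (a finite sum). The feedback law $f:\mathbb{D}_*\to\{-1,0,1\}$ is $f(\rho)=\mathrm{Argmin}_{\upsilon\in\{-1,0,1\}}\ \mathbb{E}\left[V_\epsilon(\rho_{k+1})\mid\rho_k=\rho,\,u_k=\upsilon\right]$, i.e. $f(\rho)$ is a minimizer (with ties broken by any fixed choice). *)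

(* Defs.v *)
From HB Require Import structures.
From mathcomp Require Import all_boot all_order all_algebra.
From mathcomp Require Import sesquilinear complex.
From mathcomp Require Import all_classical all_reals all_analysis.

Set Implicit Arguments.
Unset Strict Implicit.
Unset Printing Implicit Defensive.

Import Order.TTheory GRing.Theory Num.Theory.
Import numFieldNormedType.Exports.

Local Open Scope classical_set_scope.
Local Open Scope ring_scope.
Local Open Scope complex_scope.

Inductive outcome := og | oe.

(* The control values u = -1, 0, +1. *)
Inductive control := um1 | u0 | up1.

Section FockSpace.
Context {R : realType} {H : completeNormedModType R[i]}.

(* The forms of the library are linear in their first argument, whereas
   <x|y> is linear in y. *)
Definition braket (ip : {dot H for Num.conj}) (x y : H) : R[i] := ip y x.

(* The norm of H is the one of the inner product, so that H is a Hilbert space,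
   and (|n>)_n is an orthonormal basis of it. *)
Record fock_basis (ip : {dot H for Num.conj}) (ket : nat -> H) : Prop := {
  fock_norm : forall x, `|x| ^+ 2 = braket ip x x;
  fock_orthonormal : forall m n, braket ip (ket m) (ket n) = (m == n)%:R;
  fock_expansion : forall x,
    series (fun n => braket ip (ket n) x *: ket n) @ \oo --> x }.

(* A linear map between normed modules is bounded iff it is continuous
   (linear_bounded_continuous). *)
Definition bounded_operator (A : H -> H) : Prop := linear A /\ continuous A.

Definition adjoint_of (ip : {dot H for Num.conj}) (A Ad : H -> H) : Prop :=
  forall x y, braket ip (Ad x) y = braket ip x (A y).

Definition entry ip (ket : nat -> H) (A : H -> H) (m n : nat) : R[i] :=
  braket ip (ket m) (A (ket n)).

(* Limits in the field R[i] are taken in R[i]^o, which carries its topology. *)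
Definition trace ip ket (A : H -> H) : R[i] :=
  limn (series (fun n => entry ip ket A n n) : nat -> R[i]^o).

(* For a non-negative operator |A| = A, hence A is trace-class iff the series
   of its diagonal entries converges. *)
Record density_operator ip ket (rho : H -> H) : Prop := {
  density_bounded : bounded_operator rho;
  density_selfadjoint : adjoint_of ip rho rho;
  density_ge0 : forall x, 0 <= braket ip x (rho x);
  density_trace_class :
    cvgn (series (fun n => entry ip ket rho n n) : nat -> R[i]^o);
  density_trace1 : trace ip ket rho = 1 }.

Definition density_upto ip ket (nstar : nat) (rho : H -> H) : Prop :=
  density_operator ip ket rho /\ forall n, (nstar < n)%N -> rho (ket n) = 0.

Definition density_star ip ket (rho : H -> H) : Prop :=
  exists nstar, density_upto ip ket nstar rho.

Record measurement_operators (ket : nat -> H) (phi0 phiR theta0 : R)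
    (M : outcome -> control -> H -> H) : Prop := {
  meas_bounded : forall y u, bounded_operator (M y u);
  meas_g0 : forall n,
    M og u0 (ket n) = (cos ((phi0 * n%:R + phiR) / 2))%:C *: ket n;
  meas_e0 : forall n,
    M oe u0 (ket n) = (sin ((phi0 * n%:R + phiR) / 2))%:C *: ket n;
  meas_gp1 : forall n,
    M og up1 (ket n) = (sin (theta0 / 2 * Num.sqrt n.+1%:R))%:C *: ket n.+1;
  meas_ep1 : forall n,
    M oe up1 (ket n) = (cos (theta0 / 2 * Num.sqrt n.+1%:R))%:C *: ket n;
  meas_gm1 : forall n,
    M og um1 (ket n) = (cos (theta0 / 2 * Num.sqrt n%:R))%:C *: ket n;
  meas_em1 : forall n, (0 < n)%N ->
    M oe um1 (ket n) = (sin (theta0 / 2 * Num.sqrt n%:R))%:C *: ket n.-1;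
  meas_em1_0 : M oe um1 (ket 0%N) = 0 }.

Section ClosedLoop.
Context (ip : {dot H for Num.conj}) (ket : nat -> H).
(* Madj y u stands for the adjoint of M y u. *)
Context (M Madj : outcome -> control -> H -> H).

Definition unnormalized (y : outcome) (u : control) (rho : H -> H) : H -> H :=
  fun x => M y u (rho (Madj y u x)).

(* The trace is real when rho is a density operator. *)
Definition outcome_prob (y : outcome) (u : control) (rho : H -> H) : R :=
  complex.Re (trace ip ket (unnormalized y u rho)).

(* The null operator when the outcome has probability 0, as 0^-1 = 0. *)
Definition post_state (y : outcome) (u : control) (rho : H -> H) : H -> H :=
  fun x => ((outcome_prob y u rho)^-1)%:C *: unnormalized y u rho x.

Definition population (rho : H -> H) (n : nat) : R :=
  complex.Re (entry ip ket rho n n).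

Definition lyapunov (nbar : nat) (eps : R) (rho : H -> H) : R :=
  limn (series (fun n => population rho n * (n%:R - nbar%:R) ^+ 2))
  - eps * limn (series (fun n => population rho n ^+ 2)).

(* E[V(rho_{k+1}) | rho_k = rho, u_k = u]; an outcome of probability 0
   contributes 0. *)
Definition expected_lyapunov nbar eps (u : control) (rho : H -> H) : R :=
  outcome_prob og u rho * lyapunov nbar eps (post_state og u rho)
  + outcome_prob oe u rho * lyapunov nbar eps (post_state oe u rho).

(* f(rho) is an arbitrary minimizer, and its values outside D_* are
   irrelevant. *)
Definition argmin_feedback nbar eps (f : (H -> H) -> control) : Prop :=
  forall rho, density_star ip ket rho -> forall u,
    expected_lyapunov nbar eps (f rho) rho <= expected_lyapunov nbar eps u rho.

(* As rho_0 is deterministic and there are two outcomes, rho_k is almost surely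
   in a finite set; the law of y_k given the past states is thus expressed by
   elementary conditioning on {rho_0 = r_0, ..., rho_k = r_k}.  The state after
   an outcome of probability 0, which almost surely does not occur, is left
   unspecified. *)
Record closed_loop_process (f : (H -> H) -> control) (rho0 : H -> H)
    {d : measure_display} {T : measurableType d} (P : probability T R)
    (rho : nat -> T -> H -> H) (y : nat -> T -> outcome) : Prop := {
  state_measurable : forall k r, measurable [set w | rho k w = r];
  outcome_measurable : forall k a, measurable [set w | y k w = a];
  state_init : forall w, rho 0%N w = rho0;
  state_next : forall k w,
    0 < outcome_prob (y k w) (f (rho k w)) (rho k w) ->
    rho k.+1 w = post_state (y k w) (f (rho k w)) (rho k w);
  outcome_law : forall k (r : nat -> H -> H) a,
    let past := [set w | forall j, (j <= k)%N -> rho j w = r j] in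
    P (past `&` [set w | y k w = a])
    = ((outcome_prob a (f (r k)) (r k))%:E * P past)%E }.

End ClosedLoop.

Definition fock_state ip (ket : nat -> H) (n : nat) : H -> H :=
  fun x => braket ip (ket n) x *: ket n.

End FockSpace.

(* Main.v *)
Require Import Defs.
From HB Require Import structures.
From mathcomp Require Import all_boot all_order all_algebra.
From mathcomp Require Import sesquilinear complex.
From mathcomp Require Import all_classical all_reals all_analysis.
From mathcomp Require Import ring lra zify.

Set Implicit Arguments.
Unset Strict Implicit.
Unset Printing Implicit Defensive.

Import Order.TTheory GRing.Theory Num.Theory.
Import numFieldNormedType.Exports.

Local Open Scope classical_set_scope.
Local Open Scope ring_scope.
Local Open Scope complex_scope.

(** The entries that matter are the populations p n = <n|rho|n>.  Every
    measurement operator maps a Fock state to a multiple of a Fock state, so the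
    populations evolve on their own: at level n the outcome g has a probability
    w n, and the population is then carried to a neighbouring level
    (adjoint_ket, sum_source_target).  A state of D_* has finitely many nonzero
    populations, and all sums below are finite.

    Why the feedback stabilizes.  Let d n = (n - nbar)^2 and
    V = sum p n * d n - eps * sum p n ^ 2.  For any control, the expected
    decrease of V in one step is at least
      sum p n * drift n + eps * sum p n ^ 2 * (w n - g)^2,
    where drift n is the expected decrease of d starting from level n and
    g = sum p n * w n is the probability of the outcome g: the first sum is
    exact, and the second one is a quantitative form of the convexity of the
    square (jensen_gap, measurement_gain, expected_gain).  The control 0 has no
    drift, and the irrationality of phi0 / pi makes its w injective (phase_inj):
    its gain vanishes only for the populations of a Fock state.  At a level m <> nbar, one of the
    controls +1 and -1 has a positive drift, by the irrationality of
    (theta0 / pi)^2 (drift_towards).  The feedback maximizes the gain, so its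
    gain Q dominates that of every fixed control.

    Why the gain tends to 0.  V + eps >= 0 is a supermartingale with decrease
    Q >= 0, so Y_k = V(rho_k) + eps + sum_(j < k) Q(rho_j) is a nonnegative
    supermartingale; by Doob's maximal inequality it is almost surely bounded
    (supermartingale_ae_bounded).  Hence almost surely the moments
    sum p n * d n stay bounded and the series of the gains converges, so that
    Q(rho_k) tends to 0.

    Why the populations then converge (populations_cvg, on one trajectory).
    The convexity gains of the control 0 tend to 0 and its w is injective, so the products
    p_k n * p_k m with n <> m tend to 0.  The bound on the moments makes the
    distributions p_k tight, so p_k m * (1 - p_k m) tends to 0 for every m:
    each p_k is nearly a Fock state.  It cannot be near a Fock state m <> nbar,
    where the drift gain would exceed a positive constant: near m, the other
    levels contribute little, because the drift is at most linear in n while the moments of d are bounded.  So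
    p_k m tends to 0 for m <> nbar and, by tightness, p_k nbar tends to 1. *)

(** * Arithmetic of the measurement angles *)

Lemma sin_eq0_mulpi (R : realType) (x : R) :
  sin x = 0 -> exists k : int, x = k%:~R * pi.
Proof.
move=> sx0; pose k := Num.floor (x / pi); exists k.
have pi0 := pi_gt0 R.
have sin_shift (n : nat) (z : R) : sin (z + n%:R * pi) = (-1) ^+ n * sin z.
  by rewrite mulr_natl (alternatingn (@sinDpi R)).
have [kx xk] : k%:~R * pi <= x /\ x < (k + 1)%:~R * pi.
  by rewrite -ler_pdivlMr// -ltr_pdivrMr// floor_le floorD1_gt.
have [t xE] : exists t, x = t + k%:~R * pi by exists (x - k%:~R * pi); rewrite subrK.
have st0 : sin t = 0.
  case: k xE {kx xk} => n xE.
    move: sx0; rewrite xE sin_shift => /eqP.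
    by rewrite mulf_eq0 signr_eq0/= => /eqP.
  have -> : t = x + n.+1%:R * pi by rewrite xE NegzE mulrNz mulNr subrK.
  by rewrite sin_shift sx0 mulr0.
have t0 : 0 <= t by move: kx; rewrite xE; lra.
have tpi : t < pi by move: xk; rewrite xE intrD; lra.
suff t00 : t = 0 by rewrite xE t00 add0r.
apply/eqP; apply: contraT => tN0.
have : 0 < sin t by apply: sin_gt0_pi; rewrite tpi andbT lt_def tN0.
by rewrite st0 ltxx.
Qed.

Lemma irrational_intrM (R : realType) (x : R) (a b : int) :
  irrational x -> a%:~R * x = b%:~R -> a = 0.
Proof.
move=> xirr xE; apply/eqP; apply: contraT => a0; case: xirr.
have aR0 : (a%:~R : R) != 0 by rewrite intr_eq0.
exists (b%:~R / a%:~R) => //.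
by rewrite fmorph_div /= !ratr_int -xE mulrAC divff// mul1r.
Qed.

(** cos^2 a - cos^2 b = - sin (a + b) * sin (a - b).  A zero of the second
    factor makes phi0 / pi rational.  The choice of phiR gives
    a + b = pi / 2 + (m + n - 2 nbar) * phi0 / 2, so a zero of the first factor
    does too, unless m + n = 2 nbar, where pi / 2 would be a multiple of pi. *)
Lemma phase_inj (R : realType) (phi0 phiR : R) (nbar : nat) :
  irrational (phi0 / pi) -> phiR = pi / 2 - nbar%:R * phi0 ->
  injective (fun n : nat => cos ((phi0 * n%:R + phiR) / 2) ^+ 2).
Proof.
move=> irr phiRE m n /eqP; rewrite -subr_eq0 => /eqP cE.
have pi0 : (pi : R) != 0 by rewrite gt_eqF// pi_gt0.
set a := (phi0 * m%:R + phiR) / 2 in cE.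
set b := (phi0 * n%:R + phiR) / 2 in cE.
have : sin (a + b) * sin (a - b) = 0.
  rewrite sinD sinB mulrC -subr_sqr !exprMn !sin2cos2.
  by rewrite -[RHS]oppr0 -cE; ring.
move=> /eqP; rewrite mulf_eq0 => /orP[] /eqP /sin_eq0_mulpi[k kE].
- have : (m%:Z + n%:Z - 2 * nbar%:Z) = 0 /\ 2 * k - 1 = 0 :> int.
    have E : (m%:Z + n%:Z - 2 * nbar%:Z)%:~R * (phi0 / pi) = (2 * k - 1)%:~R.
      rewrite !(intrD, intrM, mulrNz) /=.
      apply: (mulIf pi0); rewrite mulrA divfK//.
      have : 2 * (a + b) = 2 * (k%:~R * pi) by rewrite kE.
      rewrite /a /b phiRE !pmulrn; lra.
    have z0 := irrational_intrM irr E; split=> //.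
    by move: E; rewrite z0 mul0r => /esym/eqP; rewrite intr_eq0 => /eqP.
  by move=> [_ k1]; exfalso; lia.
- have E : (m%:Z - n%:Z)%:~R * (phi0 / pi) = (2 * k)%:~R.
    rewrite !(intrD, intrM, mulrNz) /=.
    apply: (mulIf pi0); rewrite mulrA divfK//.
    have : 2 * (a - b) = 2 * (k%:~R * pi) by rewrite kE.
    rewrite /a /b !pmulrn; lra.
  have /eqP := irrational_intrM irr E.
  by rewrite subr_eq0 => /eqP[].
Qed.

(** A zero would give theta0 / pi * sqrt m = 2 k with k an integer; squaring
    removes the root. *)
Lemma sin_sqrt_neq0 (R : realType) (theta0 : R) (m : nat) :
  irrational ((theta0 / pi) ^+ 2) -> (0 < m)%N ->
  sin (theta0 / 2 * Num.sqrt m%:R) != 0.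
Proof.
move=> irr m0; apply/eqP => /sin_eq0_mulpi[k kE].
have pi0 : (pi : R) != 0 by rewrite gt_eqF// pi_gt0.
have E : m%:Z%:~R * (theta0 / pi) ^+ 2 = ((2 * k) ^+ 2)%:~R.
  have H : theta0 / pi * Num.sqrt m%:R = (2 * k)%:~R.
    by apply: (mulIf pi0); rewrite mulrAC divfK// intrM /=; move: kE; lra.
  by rewrite rmorphXn/= -H [in RHS]exprMn sqr_sqrtr ?ler0n// [RHS]mulrC.
by have := irrational_intrM irr E; case: m m0 {kE E}.
Qed.

(** * Finitely supported distributions and the gain of a measurement *)

(** N need not be sharp: it only bounds the support, so that sums over all
    levels are finite. *)
Record pmf (R : numDomainType) (N : nat) (p : nat -> R) : Prop := {
  pmf_ge0 : forall n, 0 <= p n;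
  pmf_supp : forall n, (N <= n)%N -> p n = 0;
  pmf_sum : \sum_(0 <= n < N) p n = 1 }.

Lemma sum_finsupp (V : nmodType) (f : nat -> V) (N M : nat) :
  (N <= M)%N -> (forall n, (N <= n)%N -> f n = 0) ->
  \sum_(0 <= n < M) f n = \sum_(0 <= n < N) f n.
Proof.
move=> NM f0; rewrite (big_cat_nat (leq0n N) NM)//= [X in _ + X]big_nat_cond.
rewrite [X in _ + X]big1 ?addr0//.
by move=> n /andP[/andP[Nn _] _]; exact: f0.
Qed.

Lemma sum_ge_term (R : numDomainType) (f : nat -> R) (N m : nat) :
  (forall n, 0 <= f n) -> (m < N)%N -> f m <= \sum_(0 <= n < N) f n.
Proof.
by move=> f0 mN; rewrite (bigD1_seq m) ?mem_index_iota ?iota_uniq//= lerDl sumr_ge0.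
Qed.

Lemma pmf_widen (R : numDomainType) (N M : nat) (p : nat -> R) :
  (N <= M)%N -> pmf N p -> pmf M p.
Proof.
move=> NM [p0 pN p1]; split=> //; last by rewrite (sum_finsupp NM).
by move=> n /(leq_trans NM); exact: pN.
Qed.

Lemma pmf_le1 (R : numDomainType) (N : nat) (p : nat -> R) m :
  pmf N p -> p m <= 1.
Proof.
move=> pP; have [mN|Nm] := ltnP m N; last by rewrite (pmf_supp pP).
by rewrite -(pmf_sum pP) (sum_ge_term (pmf_ge0 pP)).
Qed.

(** For 0 < g < 1 the right-hand side is exactly
    p^2 * (w - g)^2 / (g * (1 - g)), and g * (1 - g) <= 1.  The two implications
    cover an outcome of probability 0, where 0^-1 = 0. *)
Lemma jensen_gap (R : realFieldType) (w p g : R) :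
  0 <= g <= 1 -> (g = 0 -> w * p = 0) -> (g = 1 -> (1 - w) * p = 0) ->
  p ^+ 2 * (w - g) ^+ 2
  <= g^-1 * (w * p) ^+ 2 + (1 - g)^-1 * ((1 - w) * p) ^+ 2 - p ^+ 2.
Proof.
move=> /andP[g0 g1] hg he.
have [gz|gn0] := eqVneq g 0.
  by rewrite gz invr0 !subr0 invr1 -exprMn [p * w]mulrC mulrBl (hg gz); lra.
have [go|gn1] := eqVneq g 1.
  have wp : w * p = p by have := he go; lra.
  rewrite go (he go) wp subrr invr0 invr1 -exprMn.
  have -> : p * (w - 1) = 0 by rewrite mulrBr mulr1 mulrC wp subrr.
  by lra.
have g00 : 0 < g by rewrite lt_def gn0.
have g11 : 0 < 1 - g by rewrite subr_gt0 lt_neqAle gn1.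
have -> : g^-1 * (w * p) ^+ 2 + (1 - g)^-1 * ((1 - w) * p) ^+ 2 - p ^+ 2 =
  p ^+ 2 * (w - g) ^+ 2 * (g * (1 - g))^-1.
  by field; rewrite gn0 gt_eqF.
apply: ler_peMr; first by rewrite mulr_ge0 ?sqr_ge0.
by rewrite invf_ge1 ?mulr_gt0//; nra.
Qed.

(** The two bracketed terms on the right are the contributions of the outcomes to
    the expected value of sum p n * d n - eps * sum p n ^ 2 after a measurement
    whose first outcome has probability w n at level n, and which moves level n
    to tg n or te n.  Dividing the new populations by the probability g of the
    outcome and multiplying by g leaves the linear part unchanged, and puts the
    factor g^-1 in front of the quadratic part; the latter can then be compared
    level by level. *)
Lemma measurement_gain (R : realFieldType) (N : nat) (p w d : nat -> R)
    (tg te : nat -> nat) (eps g : R) :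
  pmf N p -> (forall n, 0 <= w n <= 1) -> 0 <= eps ->
  g = \sum_(0 <= n < N) w n * p n ->
  \sum_(0 <= n < N) p n * (d n - w n * d (tg n) - (1 - w n) * d (te n))
  + eps * \sum_(0 <= n < N) p n ^+ 2 * (w n - g) ^+ 2
  <= (\sum_(0 <= n < N) p n * d n - eps * \sum_(0 <= n < N) p n ^+ 2)
     - ((\sum_(0 <= n < N) w n * p n * d (tg n)
         - eps * (g^-1 * \sum_(0 <= n < N) (w n * p n) ^+ 2))
        + (\sum_(0 <= n < N) (1 - w n) * p n * d (te n)
         - eps * ((1 - g)^-1 * \sum_(0 <= n < N) ((1 - w n) * p n) ^+ 2))).
Proof.
move=> pP w01 eps0 gS.
have p0 := pmf_ge0 pP.
have wp0 n : 0 <= w n * p n by have /andP[? _] := w01 n; rewrite mulr_ge0.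
have wq0 n : 0 <= (1 - w n) * p n.
  by have /andP[_ ?] := w01 n; rewrite mulr_ge0// subr_ge0.
have gE : 1 - g = \sum_(0 <= n < N) (1 - w n) * p n.
  by rewrite gS -[1 in LHS](pmf_sum pP) -sumrB; apply: eq_bigr => n _; ring.
have g01 : 0 <= g <= 1.
  by rewrite -[X in _ && X]subr_ge0 gE gS !sumr_ge0.
have zero_term (f : nat -> R) n : (forall n, 0 <= f n) ->
    (forall n, (N <= n)%N -> f n = 0) -> \sum_(0 <= n < N) f n = 0 -> f n = 0.
  move=> f0 fN s0; have [nN|] := ltnP n N; last exact: fN.
  by apply/eqP; rewrite eq_le f0 andbT -s0 sum_ge_term.
have -> : forall a b c x y u v : R, (a - eps * b) - ((c - eps * (x * y)) +
    (u - eps * v)) = (a - c - u) + eps * (x * y + v - b) by move=> *; ring.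
rewrite lerD//.
  by rewrite -!sumrB; apply/ler_sum => n _; rewrite le_eqVlt; apply/orP; left; apply/eqP; ring.
rewrite ler_wpM2l// !mulr_sumr -big_split/= -sumrB; apply: ler_sum => n _.
have wN k : (N <= k)%N -> w k * p k = 0 by move=> /(pmf_supp pP) ->; rewrite mulr0.
have wqN k : (N <= k)%N -> (1 - w k) * p k = 0.
  by move=> /(pmf_supp pP) ->; rewrite mulr0.
apply: jensen_gap => // gz.
  by apply: (zero_term (fun n => w n * p n)); rewrite -?gS.
by apply: (zero_term (fun n => (1 - w n) * p n)); rewrite -?gE ?gz ?subrr.
Qed.

(** * Convergence of the populations along a trajectory *)

Lemma pmf_sum_delta (R : numDomainType) (N m : nat) (p : nat -> R) :
  pmf N p -> \sum_(0 <= n < N) p n * (n == m)%:R = p m.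
Proof.
move=> pP; have z n : n != m -> p n * (n == m)%:R = 0 by move=> /negPf ->; rewrite mulr0.
have [mN|Nm] := ltnP m N.
  rewrite (bigD1_seq m) ?mem_index_iota ?iota_uniq//= eqxx mulr1 big1 ?addr0//.
rewrite (pmf_supp pP Nm) big1_seq// => n; rewrite mem_index_iota => /andP[_ nN].
by rewrite z// ltn_eqF// (leq_trans nN).
Qed.

(** Chebyshev's inequality: beyond nbar + K the squared distance to nbar is at
    least K.+1, so these levels carry a mass at most C / K.+1. *)
Lemma pmf_tail (R : realFieldType) (N m nbar K : nat) (p : nat -> R) (C : R) :
  pmf N p -> \sum_(0 <= n < N) p n * (n%:R - nbar%:R) ^+ 2 <= C ->
  1 - p m <= \sum_(0 <= n < nbar + K.+1 | n != m) p n + C / K.+1%:R.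
Proof.
move=> pP pC; have p0 := pmf_ge0 pP.
pose M := (nbar + K.+1 + N + m.+1)%N.
have pM : pmf M p by apply: pmf_widen pP; rewrite /M -addnA addnCA leq_addr.
rewrite -[1 in X in X <= _](pmf_sum pM).
rewrite (bigD1_seq m) ?mem_index_iota ?iota_uniq//=; last by rewrite /M; lia.
rewrite addrAC subrr add0r (@big_cat_nat _ _ _ (nbar + K.+1))//=; last by rewrite /M; lia.
rewrite lerD2l ler_pdivlMr// mulr_suml.
have pC' : \sum_(0 <= n < M) p n * (n%:R - nbar%:R) ^+ 2 <= C.
  rewrite (@sum_finsupp _ _ N)//; first by rewrite /M; lia.
  by move=> n /(pmf_supp pP) ->; rewrite mul0r.
apply: le_trans pC'.
rewrite [leRHS](@big_cat_nat _ _ _ (nbar + K.+1))//=; last by rewrite /M; lia.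
apply: ler_wpDl; first by apply: sumr_ge0 => n _; rewrite mulr_ge0 ?sqr_ge0.
rewrite big_mkcond/= big_nat_cond [leRHS]big_nat_cond; apply: ler_sum => n /andP[/andP[Ln _] _].
case: ifP => _; last by rewrite mulr_ge0 ?sqr_ge0.
rewrite ler_wpM2l// -natrB; last by lia.
by rewrite -natrX ler_nat -mulnn; nia.
Qed.

(** If D is at least delta at level m and grows at most linearly, a mean of D
    close to 0 prevents p from being concentrated at m: away from m,
    - D n <= 2 * |n - nbar| + 1 <= (K.+1 + 1) + (n - nbar)^2 / K.+1, whose mean is
    controlled by 1 - p m and by the second moment. *)
Lemma pmf_drift_ge (R : realFieldType) (N m nbar K : nat) (p D : nat -> R)
    (C delta : R) :
  pmf N p -> \sum_(0 <= n < N) p n * (n%:R - nbar%:R) ^+ 2 <= C ->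
  delta <= D m -> (forall n, `|D n| <= 2 * `|n%:R - nbar%:R| + 1) ->
  delta * p m <= \sum_(0 <= n < N) p n * D n
    + (K.+1%:R + 1) * (1 - p m) + C / K.+1%:R.
Proof.
move=> pP pC dm Dn; have p0 := pmf_ge0 pP.
set k : R := K.+1%:R.
have k0 : 0 < k by rewrite ltr0n.
clearbody k.
have : \sum_(0 <= n < N) (p n * (n == m)%:R * (delta + k + 1)
    - (k + 1) * p n - p n * (n%:R - nbar%:R) ^+ 2 / k)
    <= \sum_(0 <= n < N) p n * D n.
  apply: ler_sum => n _.
  have -> : p n * (n == m)%:R * (delta + k + 1) - (k + 1) * p n
      - p n * (n%:R - nbar%:R) ^+ 2 / k =
    p n * ((n == m)%:R * (delta + k + 1) - (k + 1) - (n%:R - nbar%:R) ^+ 2 / k).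
    by field; rewrite gt_eqF.
  apply: ler_wpM2l => //.
  have := Dn n; rewrite ler_norml; set x : R := n%:R - nbar%:R => /andP[Dl _].
  have x2 : x ^+ 2 / k = `|x| ^+ 2 / k by rewrite real_normK// num_real.
  have [nm|_] := eqVneq n m.
    have : 0 <= x ^+ 2 / k by rewrite divr_ge0 ?sqr_ge0// ltW.
    by rewrite mul1r nm; lra.
  have : 2 * `|x| <= k + `|x| ^+ 2 / k.
    rewrite -subr_ge0.
    have -> : k + `|x| ^+ 2 / k - 2 * `|x| = (k - `|x|) ^+ 2 / k.
      by field; rewrite gt_eqF.
    by rewrite divr_ge0 ?sqr_ge0// ltW.
  by rewrite mul0r x2; lra.
rewrite !sumrB -!mulr_suml -mulr_sumr (pmf_sum_delta m pP) (pmf_sum pP).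
have : (\sum_(0 <= n < N) p n * (n%:R - nbar%:R) ^+ 2) / k <= C / k.
  by rewrite ler_pM2r// invr_gt0.
lra.
Qed.

(** The form in which tightness is used: the truncation level K is fixed first,
    then the time k tends to infinity. *)
Lemma cvg0_approx (R : realType) (x : R^nat) (u : nat -> R^nat) (A : R) :
  (forall k, 0 <= x k) -> (forall K k, x k <= u K k + A / K.+1%:R) ->
  (forall K, u K @ \oo --> 0) -> x @ \oo --> 0.
Proof.
move=> x0 xu u0; apply/cvgrPdist_lt => e e0.
have [K AK] : exists K : nat, A / K.+1%:R < e / 2.
  exists (Num.truncn (A / (e / 2))); rewrite ltr_pdivrMr// mulrC.
  by rewrite -ltr_pdivrMr ?divr_gt0// truncnS_gt.
have /cvgrPdist_lt/(_ (e / 2)) := u0 K; rewrite divr_gt0// => /(_ isT).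
apply: filterS => k; rewrite !sub0r !normrN (ger0_norm (x0 k)) => /ltr_normlW uk.
by rewrite (le_lt_trans (xu K k))// [ltRHS]splitr ltrD.
Qed.

Lemma cvg0_sqr (R : realType) (x : R^nat) :
  (fun k => x k ^+ 2) @ \oo --> 0 -> x @ \oo --> 0.
Proof.
move=> x2; apply/norm_cvg0P.
have -> : (fun k => `|x k|) = (fun k => Num.sqrt (x k ^+ 2)).
  by apply/funext => k; rewrite sqrtr_sqr.
have -> : (0 : R) = Num.sqrt 0 by rewrite sqrtr0.
apply: continuous_cvg; [exact: sqrt_continuous|exact: x2].
Qed.

Lemma cvg0_sum (R : realType) (u : nat -> R^nat) (L : nat) (P : pred nat) :
  (forall n, P n -> u n @ \oo --> 0) ->
  (fun k => \sum_(0 <= n < L | P n) u n k) @ \oo --> 0.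
Proof.
move=> u0; elim: L => [|L IH].
  by under eq_fun do rewrite big_geq//; exact: cvg_cst.
under eq_fun do rewrite big_mkcond/= big_nat_recr//= -big_mkcond/=.
have uL : (fun k => if P L then u L k else 0) @ \oo --> (0 : R).
  by have [/u0//|_] := boolP (P L); exact: cvg_cst.
have H := cvgD IH uL; rewrite addr0 in H; exact: H.
Qed.

(** Q k is the gain at time k, which dominates the gains of all the controls: the
    convexity gains of the control 0 and, for each level m <> nbar, a drift that
    is positive at m. *)
Lemma populations_cvg (R : realType) (nbar : nat) (eps C : R) (c : nat -> R)
    (N : nat -> nat) (p : nat -> nat -> R) (a Q : nat -> R) :
  0 < eps -> injective c -> (forall k, pmf (N k) (p k)) ->
  (forall k n, eps * (p k n ^+ 2 * (c n - a k) ^+ 2) <= Q k) ->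
  (forall m : nat, m != nbar -> exists (delta : R) (D : nat -> R), [/\ 0 < delta, delta <= D m,
     forall n : nat, `|D n| <= 2 * `|n%:R - nbar%:R| + 1 &
     forall k, \sum_(0 <= n < N k) p k n * D n <= Q k]) ->
  (forall k, \sum_(0 <= n < N k) p k n * (n%:R - nbar%:R) ^+ 2 <= C) ->
  Q @ \oo --> 0 ->
  forall m, (fun k => p k m) @ \oo --> ((m == nbar)%:R : R).
Proof.
move=> eps0 cinj pP qnd drift pC Q0.
have Qge0 k : 0 <= Q k.
  apply: le_trans (qnd k 0%N).
  by rewrite mulr_ge0 ?(ltW eps0)// mulr_ge0 ?sqr_ge0.
have p0 k n : 0 <= p k n := pmf_ge0 (pP k) n.
have p1 k n : p k n <= 1 := pmf_le1 n (pP k).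
(* c n and c m cannot both be close to a k. *)
have pair0 m n : n != m -> (fun k => p k n * p k m) @ \oo --> (0 : R).
  move=> nm; apply: cvg0_sqr.
  have cnm : 0 < (c n - c m) ^+ 2.
    by rewrite exprn_even_gt0//= subr_eq0 (inj_eq cinj).
  pose B := 4 / (eps * (c n - c m) ^+ 2).
  have : (fun k => B * Q k) @ \oo --> (0 : R).
    by rewrite -(mulr0 B); apply: cvgMl_tmp.
  apply: (squeeze_cvgr _ (cvg_cst (0 : R))); apply: nearW => k.
  rewrite sqr_ge0/= /B mulrAC ler_pdivlMr ?(mulr_gt0 eps0 cnm)//.
  have := qnd k n; have := qnd k m; have := p0 k n; have := p0 k m.
  have := p1 k n; have := p1 k m.
  move: (p k n) (p k m) (c n) (c m) (a k) (Q k) => x y u v z q.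
  move=> y1 x1 y0 x0 hy hx.
  have E1 : (x * y) ^+ 2 * (u - v) ^+ 2 <=
      2 * (x ^+ 2 * (u - z) ^+ 2) + 2 * (y ^+ 2 * (v - z) ^+ 2).
    have : (x * y) ^+ 2 * (u - v) ^+ 2 <=
       2 * ((x * y) ^+ 2 * (u - z) ^+ 2) + 2 * ((x * y) ^+ 2 * (v - z) ^+ 2).
      have : 0 <= (x * y * (u - z + (v - z))) ^+ 2 by exact: sqr_ge0.
      rewrite !exprMn; nra.
    have : (x * y) ^+ 2 * (u - z) ^+ 2 <= x ^+ 2 * (u - z) ^+ 2.
      rewrite ler_wpM2r ?sqr_ge0// exprMn ler_piMr ?sqr_ge0//.
      by rewrite expr_le1.
    have : (x * y) ^+ 2 * (v - z) ^+ 2 <= y ^+ 2 * (v - z) ^+ 2.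
      rewrite ler_wpM2r ?sqr_ge0// exprMn ler_piMl ?sqr_ge0//.
      by rewrite expr_le1.
    lra.
  have -> : (x * y) ^+ 2 * (eps * (u - v) ^+ 2) =
     eps * ((x * y) ^+ 2 * (u - v) ^+ 2) by ring.
  have := ler_wpM2l (ltW eps0) E1; lra.
have spread0 m : (fun k => p k m * (1 - p k m)) @ \oo --> (0 : R).
  apply: (@cvg0_approx _ _ (fun K k =>
    \sum_(0 <= n < nbar + K.+1 | n != m) p k n * p k m) C).
  - by move=> k; rewrite mulr_ge0// subr_ge0.
  - move=> K k; have tail := pmf_tail m K (pP k) (pC k).
    have Cge0 : 0 <= C / K.+1%:R.
      rewrite divr_ge0//; apply: le_trans (pC k).
      by apply: sumr_ge0 => n _; rewrite mulr_ge0// sqr_ge0.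
    apply: le_trans (ler_wpM2l (p0 k m) tail) _.
    rewrite mulrDr lerD ?ler_piMl// mulr_sumr.
    by apply: ler_sum => n _; rewrite mulrC.
  - by move=> K; apply: (@cvg0_sum _ (fun n k => p k n * p k m)) => n; exact: pair0.
(* Multiplying the bound of pmf_drift_ge by p k m turns 1 - p k m into the
   quantity of spread0, which tends to 0. *)
have other0 m : m != nbar -> (fun k => p k m) @ \oo --> (0 : R).
  move=> mn; have [delta [D [d0 dm Dn Dsum]]] := drift m mn.
  apply: cvg0_sqr.
  have h : (fun k => delta * p k m ^+ 2) @ \oo --> (0 : R).
    apply: (@cvg0_approx _ _ (fun K k =>
      Q k + (K.+1%:R + 1) * (p k m * (1 - p k m))) C).
    - by move=> k; rewrite mulr_ge0 ?sqr_ge0// ltW.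
    - move=> K k.
      have := pmf_drift_ge K (pP k) (pC k) dm Dn.
      have Cge0 : 0 <= C / K.+1%:R.
        rewrite divr_ge0//; apply: le_trans (pC k).
        by apply: sumr_ge0 => n _; rewrite mulr_ge0// sqr_ge0.
      move: (C / K.+1%:R) Cge0 => A A0; move: (K.+1%:R : R) => B.
      have := p0 k m; have := p1 k m; have := Qge0 k; have := Dsum k.
      set S := \sum_(0 <= n < N k) _.
      move: S (Q k) (p k m) => S q x Sq q0 x1 x0 H.
      have := ler_wpM2r x0 H.
      have : S * x <= q by apply: le_trans (ler_wpM2r x0 Sq) _; rewrite ler_piMr.
      have : A * x <= A by rewrite ler_piMr.
      lra.
    - move=> K; rewrite -(addr0 (0 : R)); apply: cvgD => //.
      by rewrite -(mulr0 (K.+1%:R + 1)); apply: cvgMl_tmp; exact: spread0.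
  rewrite -(mulr0 delta^-1).
  have -> : (fun k => p k m ^+ 2) = (fun k => delta^-1 * (delta * p k m ^+ 2)).
    by apply/funext => k; rewrite mulKf// gt_eqF.
  exact: cvgMl_tmp.
move=> m; have [->|/other0//] := eqVneq m nbar.
rewrite -(subr0 (1 : R)).
have h : (fun k => 1 - p k nbar) @ \oo --> (0 : R).
  apply: (@cvg0_approx _ _ (fun K k =>
    \sum_(0 <= n < nbar + K.+1 | n != nbar) p k n) C).
  - by move=> k; rewrite subr_ge0.
  - by move=> K k; exact: pmf_tail (pP k) (pC k).
  - by move=> K; apply: (@cvg0_sum _ (fun n k => p k n)) => n; exact: other0.
have -> : (fun k => p k nbar) = (fun k => 1 - (1 - p k nbar)).
  by apply/funext => k; rewrite opprB addrC subrK.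
by apply: cvgB => //; exact: cvg_cst.
Qed.

(** * Series and limits of real and complex sequences *)

Lemma cvg_series_finsupp (K : numFieldType) (V : normedModType K) (f : nat -> V) (N : nat) :
  (forall n, (N <= n)%N -> f n = 0) ->
  series f @ \oo --> \sum_(0 <= n < N) f n.
Proof.
move=> f0; apply: cvg_near_cst; exists N => // M /= NM.
by rewrite /series/= (sum_finsupp NM).
Qed.

Lemma lim_series_finsupp (K : numFieldType) (V : normedModType K) (f : nat -> V) (N : nat) :
  (forall n, (N <= n)%N -> f n = 0) ->
  limn (series f) = \sum_(0 <= n < N) f n.
Proof. by move=> f0; apply: norm_cvg_lim; exact: cvg_series_finsupp. Qed.

Lemma cvg_real_complex (R : realType) (x : R^nat) (l : R) :
  x @ \oo --> l -> (fun k => (x k)%:C : R[i]^o) @ \oo --> (l%:C : R[i]^o).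
Proof.
move=> xl; apply/cvgrPdist_lt => e e0.
have [eE eR0] : e = (complex.Re e)%:C /\ 0 < complex.Re e.
  have eE : e = (complex.Re e)%:C by rewrite RRe_real// gtr0_real.
  by split=> //; rewrite -ltcR -eE.
move/cvgrPdist_lt : xl => /(_ _ eR0); apply: filterS => k xk.
by rewrite eE -rmorphB/= normc_def/= expr0n/= addr0 sqrtr_sqr ltcR.
Qed.

Lemma bounded_sums_cvg0 (R : realType) (u : R^nat) (A : R) :
  (forall k, 0 <= u k) -> (forall k, \sum_(0 <= i < k) u i <= A) ->
  u @ \oo --> 0.
Proof.
move=> u_ge0 uA; apply: cvg_series_cvg_0; apply: nondecreasing_is_cvgn.
  apply/nondecreasing_seqP => k.
  by rewrite /series/= big_nat_recr//= lerDl.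
by exists A => _ [k _ <-]; exact: uA.
Qed.

(** * A maximal inequality for chains with two outcomes *)

Section Supermartingale.
Context {R : realType} {X : Type} (D : X -> Prop).
Context (next : outcome -> X -> X) (pr : outcome -> X -> R) (W Q : X -> R).
Context {d : measure_display} {T : measurableType d} (P : probability T R).
Context (xi : nat -> T -> X) (y : nat -> T -> outcome).

Let past k (r : nat -> X) : set T :=
  [set w | forall j, (j <= k)%N -> xi j w = r j].

(** The law is only known conditionally on the past of the states, not of the
    outcomes: the two outcomes may well lead to the same state. *)
Record binary_chain : Prop := {
  chain_pr_ge0 : forall a x, D x -> 0 <= pr a x;
  chain_pr_sum : forall x, D x -> pr og x + pr oe x = 1;
  chain_next : forall a x, D x -> 0 < pr a x -> D (next a x);
  chain_state_measurable : forall k x, measurable [set w | xi k w = x];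
  chain_outcome_measurable : forall k a, measurable [set w | y k w = a];
  chain_step : forall k w, 0 < pr (y k w) (xi k w) ->
    xi k.+1 w = next (y k w) (xi k w);
  chain_law : forall k r a,
    P (past k r `&` [set w | y k w = a]) = ((pr a (r k))%:E * P (past k r))%E }.

Record supermartingale_on : Prop := {
  super_ge0 : forall x, D x -> 0 <= W x;
  super_gain_ge0 : forall x, D x -> 0 <= Q x;
  super_decr : forall x, D x ->
    pr og x * W (next og x) + pr oe x * W (next oe x) <= W x - Q x }.

Hypothesis chain : binary_chain.
Hypothesis super : supermartingale_on.

Let mu (A : set T) : R := fine (P A).

Let mu_le A B : measurable A -> measurable B -> A `<=` B -> mu A <= mu B.
Proof.
move=> mA mB AB; apply: fine_le; rewrite ?fin_num_measure//.
by apply: le_measure; rewrite ?inE.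
Qed.

Let mu_ge0 A : 0 <= mu A.
Proof. exact: fine_ge0. Qed.

Let mu_setU A B : measurable A -> measurable B -> mu (A `|` B) <= mu A + mu B.
Proof.
move=> mA mB; rewrite /mu -fineD ?fin_num_measure//.
apply: fine_le; rewrite ?fin_numD ?fin_num_measure//; first exact: measurableU.
exact: measureU2.
Qed.

Let past_measurable k r : measurable (past k r).
Proof.
have -> : past k r = \bigcap_(j in [set j | (j <= k)%N]) [set w | xi j w = r j].
  by apply/seteqP; split.
by apply: bigcap_measurable => [|j _]; [exists 0%N|exact: chain_state_measurable].
Qed.

Let branch k r a := past k r `&` [set w | y k w = a].

Let branch_measurable k r a : measurable (branch k r a).
Proof. by apply: measurableI => //; exact: chain_outcome_measurable. Qed.

Let mu_branch k r a : mu (branch k r a) = pr a (r k) * mu (past k r).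
Proof. by rewrite /mu /branch chain_law// fineM ?fin_num_measure. Qed.

Let extend k (r : nat -> X) x : nat -> X := fun j => if j == k.+1 then x else r j.

Let past_extend k r x w :
  past k.+1 (extend k r x) w <-> past k r w /\ xi k.+1 w = x.
Proof.
rewrite /past /extend /=; split=> [h|[h hx] j].
  split=> [j jk|]; last by rewrite h ?eqxx.
  by rewrite h ?(leqW jk)// ltn_eqF// ltnS.
by rewrite leq_eqVlt => /orP[/eqP->|jk]; [rewrite eqxx|rewrite h// ltn_eqF].
Qed.

(** Only the events that the state takes one given value are known to be
    measurable, and on a null set uncountably many states may be visited, so that
    the event that W exceeds a level need not be measurable.  Probabilities are
    bounded through measurable covers instead. *)
Let covered k r lam v (B : set T) := exists E, [/\ measurable E, E `<=` past k r,
  past k r `&` B `<=` E & lam * mu E <= v * mu (past k r)].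

(** If the two outcomes lead to distinct states, the new pasts are the two
    branches and the covers add up.  Otherwise all the outcomes of positive
    probability lead to one state, whose past is the old one up to a null set,
    and a single cover serves.  The same treatment applies when one outcome has
    probability 0. *)
Let covered_step k r lam (B : set T) : D (r k) -> 0 <= lam ->
  (forall a, 0 < pr a (r k) ->
    covered k.+1 (extend k r (next a (r k))) lam (W (next a (r k))) B) ->
  covered k r lam (pr og (r k) * W (next og (r k)) + pr oe (r k) * W (next oe (r k))) B.
Proof.
set x := r k => Dx lam0 IH.
have prS := chain_pr_sum chain Dx.
have pr0 a := chain_pr_ge0 chain a Dx.
have sub a : 0 < pr a x -> branch k r a `<=` past k.+1 (extend k r (next a x)).
  move=> pa w [pw yw]; apply/past_extend; split=> //.
  have xw : xi k w = x by rewrite pw.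
  by rewrite chain_step// ?yw xw.
have sub_past a : past k.+1 (extend k r (next a x)) `<=` past k r.
  by move=> w /past_extend[].
have [[a [pa same]]|nosame] := pselect (exists a, 0 < pr a x /\
    forall b, 0 < pr b x -> next b x = next a x).
  have [E [mE Epast cover bound]] := IH a pa.
  (* The outcomes of probability 0, after which the state is unspecified. *)
  pose Z b := if pr b x == 0 then branch k r b else set0.
  have mZ b : measurable (Z b) by rewrite /Z; case: ifP.
  have Z0 b : mu (Z b) = 0.
    rewrite /Z; case: ifP => [/eqP pb|_]; first by rewrite mu_branch -/x pb mul0r.
    by rewrite /mu measure0.
  exists (E `|` (Z og `|` Z oe)); split.
  - by apply: measurableU => //; exact: measurableU.
  - by move=> w [/Epast/sub_past//|[]]; rewrite /Z; case: ifP => // _ [].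
  - move=> w [pw Bw]; have bw : branch k r (y k w) w by [].
    have [pz|pn] := eqVneq (pr (y k w) x) 0.
      right; case yw : (y k w) bw pz => bw /eqP pz; [left|right];
        by rewrite /Z pz.
    left; apply: cover; split=> //.
    have pb : 0 < pr (y k w) x by rewrite lt_def pn pr0.
    by rewrite -(same _ pb); exact: sub.
  have -> : pr og x * W (next og x) + pr oe x * W (next oe x) = W (next a x).
    have eqW b : pr b x * W (next b x) = pr b x * W (next a x).
      have [->|pn] := eqVneq (pr b x) 0; first by rewrite !mul0r.
      by rewrite (same b)// lt_def pn pr0.
    by rewrite !eqW -mulrDl prS mul1r.
  have muE : mu (E `|` (Z og `|` Z oe)) <= mu E.
    apply: le_trans (mu_setU _ _) _ => //; first exact: measurableU.
    rewrite gerDl; apply: le_trans (mu_setU _ _) _ => //.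
    by rewrite !Z0 addr0.
  apply: le_trans (ler_wpM2l lam0 muE) _; apply: le_trans bound _.
  rewrite ler_wpM2l//; last exact: mu_le.
  by apply: (super_ge0 super); exact: (chain_next chain).
have prP a : 0 < pr a x.
  rewrite lt_def pr0 andbT; apply/eqP => pa; apply: nosame.
  case: a pa => pa; [exists oe|exists og]; rewrite pa ?add0r ?addr0 in prS;
    rewrite prS; (split=> [//|[]]); rewrite ?pa ?ltxx//.
have neq : next og x <> next oe x.
  by move=> e; apply: nosame; exists og; split=> // -[].
have eq_branch a : past k.+1 (extend k r (next a x)) `<=` branch k r a.
  move=> w /past_extend[pw xw]; split=> //=.
  have bw : branch k r (y k w) w by [].
  have /past_extend[_] := sub _ (prP _) _ bw; rewrite xw.
  by case: (y k w); case: a {xw} => // e; case: neq.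
have [Eg [mEg Egpast coverg boundg]] := IH og (prP og).
have [Ee [mEe Eepast covere bounde]] := IH oe (prP oe).
exists (Eg `|` Ee); split.
- exact: measurableU.
- by move=> w [/Egpast|/Eepast] /sub_past.
- move=> w [pw Bw]; have bw : branch k r (y k w) w by [].
  by case yw : (y k w) bw => /(sub _ (prP _)) bw; [left; apply: coverg|right; apply: covere].
apply: le_trans (ler_wpM2l lam0 (mu_setU mEg mEe)) _.
rewrite mulrDr mulrDl; apply: lerD.
  apply: le_trans boundg _; rewrite mulrAC [leRHS]mulrC -mu_branch.
  rewrite ler_wpM2l//; last exact: mu_le.
  by apply: (super_ge0 super); exact: (chain_next chain).
apply: le_trans bounde _; rewrite mulrAC [leRHS]mulrC -mu_branch.
rewrite ler_wpM2l//; last exact: mu_le.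
by apply: (super_ge0 super); exact: (chain_next chain).
Qed.

(** Within n steps after time k, W plus the gains accumulated since time k
    reaches lam, or the state leaves D.  Instead of adding up the gains, each
    step lowers the threshold. *)
Let Fixpoint exceeds n k lam w : Prop :=
  (~ D (xi k w) \/ lam <= W (xi k w)) \/
  if n is n'.+1 then exceeds n' k.+1 (lam - Q (xi k w)) w else False.

(** Doob's inequality, by induction on the horizon.  If W (r k) < lam, let q be
    the probability of the event given the past, and v the mean of W after one
    step.  The induction, with the threshold lam - Q, gives
    (lam - Q) * q <= v <= W - Q, hence lam * q <= W - Q * (1 - q) <= W. *)
Let maximal_inequality n k r lam : D (r k) ->
  covered k r lam (W (r k)) (exceeds n k lam).
Proof.
elim: n k r lam => [|n IH] k r lam Drk.
  have [lamW|Wlam] := leP lam (W (r k)).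
    exists (past k r); split=> //.
    by rewrite ler_wpM2r ?mu_ge0.
  exists set0; split=> //; last first.
    by rewrite /mu measure0 mulr0 mulr_ge0 ?mu_ge0 ?(super_ge0 super).
  by move=> w [pw /=]; rewrite pw// => -[[//|]|//]; rewrite leNgt Wlam.
have [lamW|Wlam] := leP lam (W (r k)).
  exists (past k r); split=> //.
  by rewrite ler_wpM2r ?mu_ge0.
have W0 := super_ge0 super Drk.
have Q0 := super_gain_ge0 super Drk.
have decr := super_decr super Drk.
have avg0 : 0 <= pr og (r k) * W (next og (r k)) + pr oe (r k) * W (next oe (r k)).
  have t0 a : 0 <= pr a (r k) * W (next a (r k)).
    have := chain_pr_ge0 chain a Drk; rewrite le_eqVlt => /orP[/eqP<-|pa].
      by rewrite mul0r.
    apply: mulr_ge0; first exact: ltW.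
    by apply: (super_ge0 super); exact: (chain_next chain).
  exact: addr_ge0.
have lam0 : 0 <= lam - Q (r k) by lra.
have [|E [mE Epast cover bound]] :=
    @covered_step k r _ (exceeds n k.+1 (lam - Q (r k))) Drk lam0.
  move=> a pa; have /IH : D (extend k r (next a (r k)) k.+1).
    by rewrite /extend eqxx; exact: (chain_next chain).
  by move/(_ (lam - Q (r k))); rewrite {2}/extend eqxx.
exists E; split=> //.
  move=> w [pw /=]; rewrite pw// => -[[//|]|]; first by rewrite leNgt Wlam.
  by move=> ?; exact: cover.
have := mu_le mE (past_measurable k r) Epast; have := mu_ge0 E.
nra.
Qed.

(** The event that lam is ever exceeded is an increasing union over the horizons,
    so it has a cover of measure at most W x0 / lam; let lam tend to infinity. *)
Lemma supermartingale_ae_bounded x0 : D x0 -> (forall w, xi 0%N w = x0) ->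
  {ae P, forall w, exists lam, forall k, D (xi k w) /\
     W (xi k w) + \sum_(0 <= i < k) Q (xi i w) < lam}.
Proof.
move=> Dx0 xi0.
have cov m n : {E | [/\ measurable E, exceeds n 0 m.+1%:R `<=` E &
    m.+1%:R * mu E <= W x0]}.
  apply: cid; have [E [mE _ cover bound]] :=
    @maximal_inequality n 0 (fun=> x0) m.+1%:R Dx0.
  exists E; split=> //.
    by move=> w ew; apply: cover; split=> // j; rewrite leqn0 => /eqP ->.
  apply: le_trans bound _; rewrite ler_piMr ?(super_ge0 super)//.
  by rewrite /mu -lee_fin fineK ?fin_num_measure// probability_le1.
pose E m n := sval (cov m n).
have mE m n : measurable (E m n) by have [] := svalP (cov m n).
have exceedsE m n : exceeds n 0 m.+1%:R `<=` E m n by have [] := svalP (cov m n).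
have Ebound m n : m.+1%:R * mu (E m n) <= W x0 by have [] := svalP (cov m n).
(* The covers E m n need not increase with n, but the F m n do. *)
pose F m n := \bigcap_(l in [set l | (n <= l)%N]) E m l.
have mF m n : measurable (F m n).
  by apply: bigcap_measurable => //; exists n; exact: leqnn.
pose G m := \bigcup_n F m n.
have mG m : measurable (G m) by exact: bigcup_measurable.
have Gbound m : (P (G m) <= (W x0 / m.+1%:R)%:E)%E.
  have ndF : nondecreasing_seq (F m).
    by move=> a b ab; apply/subsetPset => w Fw l bl; apply: Fw; exact: leq_trans bl.
  have := nondecreasing_cvg_mu (mu := P) (mF m) (mG m) ndF.
  move=> cvF; rewrite -(cvg_lim _ cvF)//; apply: lime_le.
    by apply/cvg_ex; eexists; exact: cvF.
  apply: nearW => n /=.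
  apply: (@le_trans _ _ (P (E m n))).
    by apply: le_measure; rewrite ?inE// => w; apply; exact: leqnn.
  rewrite -[leLHS]fineK ?fin_num_measure// lee_fin ler_pdivlMr// mulrC.
  exact: Ebound.
have exceedsS n k lam w : exceeds n k lam w -> exceeds n.+1 k lam w.
  by elim: n k lam => [|n IH] k lam /= [h|h]; [left|by []|left|right; exact: IH].
have exceedsG m n : exceeds n 0 m.+1%:R `<=` G m.
  move=> w ew; exists n => // l /= nl; apply: exceedsE.
  by rewrite -(subnKC nl); elim: (l - n)%N => [|j IH]; rewrite ?addn0// addnS; exact: exceedsS.
exists (\bigcap_m G m); split.
- by apply: bigcap_measurable => //; exists 0%N.
- apply/eqP; rewrite eq_le measure_ge0 andbT; apply/lee_addgt0Pr => e e0.
  rewrite add0e; pose m := Num.truncn (W x0 / e).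
  apply: (@le_trans _ _ (P (G m))).
    apply: le_measure; rewrite ?inE//; last by move=> w; apply.
    by apply: bigcap_measurable => //; exists 0%N.
  apply: le_trans (Gbound m) _; rewrite lee_fin ler_pdivrMr// mulrC -ler_pdivrMr//.
  by rewrite ltW// /m truncnS_gt.
- move=> w nb m _; apply: contrapT => nG; apply: nb; exists m.+1%:R => k.
  have : forall n i lam, ~ exceeds n i lam w ->
      D (xi (i + n) w) /\ W (xi (i + n) w) + \sum_(0 <= j < n) Q (xi (i + j) w) < lam.
    elim=> [|n IH] i lam /=.
      rewrite addn0 big_geq// addr0 => /not_orP[/not_orP[/contrapT Di /negP]].
      by rewrite -ltNge.
    move=> /not_orP[_ /IH]; rewrite addSnnS => -[Di h]; split=> //.
    rewrite big_nat_recl// addn0 /=.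
    under eq_bigr do rewrite -addSnnS.
    lra.
  by move=> /(_ k 0%N m.+1%:R) /=; under eq_bigr do rewrite add0n; apply=> /exceedsG.
Qed.

End Supermartingale.

(** * Transport of the populations by the measurements *)

(** The adjoint of M y u maps |n> to adjoint_coef y u n times |source y u n>.  For
    the outcome g of the control +1 and n = 0, the coefficient vanishes, and the
    level given by source is a dummy. *)
Definition adjoint_coef (R : realType) (phi0 phiR theta0 : R)
    (y : outcome) (u : control) (n : nat) : R :=
  match y, u with
  | og, u0 => cos ((phi0 * n%:R + phiR) / 2)
  | oe, u0 => sin ((phi0 * n%:R + phiR) / 2)
  | og, up1 => sin (theta0 / 2 * Num.sqrt n%:R)
  | oe, up1 => cos (theta0 / 2 * Num.sqrt n.+1%:R)
  | og, um1 => cos (theta0 / 2 * Num.sqrt n%:R)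
  | oe, um1 => sin (theta0 / 2 * Num.sqrt n.+1%:R)
  end.

Definition source (y : outcome) (u : control) (n : nat) : nat :=
  match y, u with
  | og, up1 => n.-1
  | oe, um1 => n.+1
  | _, _ => n
  end.

(** The probability of the outcome g when the state is |n>. *)
Definition fock_prob_g (R : realType) (phi0 phiR theta0 : R) (u : control) (n : nat) : R :=
  match u with
  | u0 => cos ((phi0 * n%:R + phiR) / 2) ^+ 2
  | up1 => sin (theta0 / 2 * Num.sqrt n.+1%:R) ^+ 2
  | um1 => cos (theta0 / 2 * Num.sqrt n%:R) ^+ 2
  end.

Definition fock_prob (R : realType) (phi0 phiR theta0 : R) (y : outcome) u n : R :=
  if y is og then fock_prob_g phi0 phiR theta0 u n else 1 - fock_prob_g phi0 phiR theta0 u n.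

(** The level reached from n; at n = 0 the outcome e of the control -1 has
    probability 0. *)
Definition target (y : outcome) (u : control) (n : nat) : nat :=
  match y, u with
  | og, up1 => n.+1
  | oe, um1 => n.-1
  | _, _ => n
  end.

Section Transport.
Context (R : realType) (phi0 phiR theta0 : R).
Local Notation amp := (adjoint_coef phi0 phiR theta0).
Local Notation wt := (fock_prob phi0 phiR theta0).

Lemma fock_prob_g_bound u n : 0 <= fock_prob_g phi0 phiR theta0 u n <= 1.
Proof.
by case: u => /=; rewrite sqr_ge0/= ?[X in X <= _]cos2sin2 ?[X in X <= _]sin2cos2 gerBl sqr_ge0.
Qed.

(** The left-hand side lists the new populations level by level, the right-hand
    side follows each old population to the level it moves to. *)
Lemma sum_source_target y u (F : nat -> R -> R) (p : nat -> R) N :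
  (forall k, F k 0 = 0) -> (forall n, (N <= n)%N -> p n = 0) ->
  \sum_(0 <= n < N.+1) F n (amp y u n ^+ 2 * p (source y u n))
  = \sum_(0 <= n < N) F (target y u n) (wt y u n * p n).
Proof.
move=> F0 pN.
have same (a b : nat -> R) : a =1 b ->
    \sum_(0 <= n < N.+1) F n (a n * p n) = \sum_(0 <= n < N) F n (b n * p n).
  move=> ab; rewrite (sum_finsupp (leqnSn N)); last by move=> n /pN ->; rewrite mulr0.
  by apply: eq_bigr => n _; rewrite ab.
case: y; case: u; rewrite /fock_prob /=; try exact: same.
- by rewrite big_nat_recl//= sqrtr0 mulr0 sin0 expr0n mul0r F0 add0r.
- pose b n := (1 - cos (theta0 / 2 * Num.sqrt n%:R) ^+ 2) * p n.
  have bN n : (N <= n)%N -> F n.-1 (b n) = 0 by move=> /pN pn; rewrite /b pn mulr0.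
  rewrite -[RHS](sum_finsupp (leqW (leqnSn N)) bN).
  rewrite [RHS]big_nat_recl//= /b sqrtr0 mulr0 cos0 expr1n subrr mul0r F0 add0r.
  by apply: eq_bigr => n _; rewrite sin2cos2.
- by apply: same => n; rewrite sin2cos2.
- by apply: same => n; rewrite cos2sin2.
Qed.

End Transport.

(** * Density operators and measurement operators *)

Section Operators.
Context {R : realType} {H : completeNormedModType R[i]}.
Context (ip : {dot H for Num.conj}) (ket : nat -> H).
Hypothesis hbasis : fock_basis ip ket.

Let brD x u v : braket ip x (u + v) = braket ip x u + braket ip x v.
Proof. by rewrite /braket linearDl. Qed.

Let brZ x a u : braket ip x (a *: u) = a * braket ip x u.
Proof. by rewrite /braket linearZl_LR. Qed.

Let brB x u v : braket ip x (u - v) = braket ip x u - braket ip x v.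
Proof. by rewrite /braket linearBl. Qed.

Let brBl x u v : braket ip (u - v) x = braket ip u x - braket ip v x.
Proof. by rewrite /braket linearBr. Qed.

Let brZl x a u : braket ip (a *: u) x = a^*%R * braket ip u x.
Proof. by rewrite /braket linearZr_LR. Qed.

Let brC x y : braket ip x y = (braket ip y x)^*%R.
Proof. by rewrite /braket hermC expr0 mul1r. Qed.

Let conjR (x : R) : (x%:C)^*%R = x%:C.
Proof. by apply: CrealP; apply/complex_realP; exists x. Qed.

Lemma braket_inj x y :
  (forall n, braket ip (ket n) x = braket ip (ket n) y) -> x = y.
Proof.
move=> xy.
have hx := @fock_expansion _ _ _ _ hbasis x.
have hy := @fock_expansion _ _ _ _ hbasis y.
have E : (fun n => braket ip (ket n) x *: ket n) = (fun n => braket ip (ket n) y *: ket n).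
  by apply/funext => n; rewrite xy.
rewrite E in hx; exact: (norm_cvg_unique hx hy).
Qed.

Let braket_ext x y : (forall z, braket ip z x = braket ip z y) -> x = y.
Proof. by move=> xy; apply: braket_inj => n; exact: xy. Qed.

Lemma braket_real_ge0 (z : R[i]) : 0 <= z -> z = (complex.Re z)%:C /\ 0 <= complex.Re z.
Proof.
move=> z0; have zR : z = (complex.Re z)%:C by rewrite RRe_real// ger0_real.
by split=> //; rewrite -ler0c -zR.
Qed.

Lemma adjointC A Ad : adjoint_of ip A Ad ->
  forall x y, braket ip (A x) y = braket ip x (Ad y).
Proof. by move=> AAd x y; rewrite brC -AAd -brC. Qed.

Lemma adjoint_linear A Ad : adjoint_of ip A Ad -> linear Ad.
Proof.
move=> AAd a u v; apply: braket_ext => z.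
by rewrite brD brZ -!(adjointC AAd) brD brZ.
Qed.

(** Let r bound A, m = |Ad x|^2 = <x|A (Ad x)> and z = A (Ad x), so that
    |z|^2 <= r^2 * m.  Then 0 <= |r^2 x - z|^2 <= r^4 |x|^2 - r^2 m, that is,
    m <= r^2 |x|^2. *)
Lemma adjoint_bounded A Ad : adjoint_of ip A Ad ->
  bounded_operator A -> bounded_operator Ad.
Proof.
move=> AAd [linA contA]; have linAd := adjoint_linear AAd; split=> //.
pose fA : {linear H -> H} := HB.pack A (GRing.isLinear.Build _ _ _ _ A linA).
pose fAd : {linear H -> H} := HB.pack Ad (GRing.isLinear.Build _ _ _ _ Ad linAd).
have : bounded_near fA (nbhs (0 : H)) by apply/linear_bounded_continuous.
move=> /linear_boundedP/pinfty_ex_gt0[r r0 Ar].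
suff : continuous fAd by [].
apply/linear_bounded_continuous/linear_boundedP.
exists r; split; first exact: gtr0_real.
move=> s rs x; apply: (@le_trans _ _ (r * `|x|)); last by rewrite ler_wpM2r// ltW.
rewrite -(@ler_pXn2r _ 2)// ?nnegrE ?mulr_ge0 ?(ltW r0)// exprMn.
rewrite !(fock_norm hbasis) /=.
set m := braket ip (Ad x) (Ad x).
have zx : braket ip (A (Ad x)) x = m by rewrite (adjointC AAd).
have xz : braket ip x (A (Ad x)) = m by rewrite -AAd.
have : `|A (Ad x)| ^+ 2 <= r ^+ 2 * m.
  by rewrite /m -(fock_norm hbasis) -exprMn lerXn2r// ?nnegrE ?mulr_ge0 ?(ltW r0)//; exact: Ar.
rewrite (fock_norm hbasis).
have : 0 <= braket ip (r ^+ 2 *: x - A (Ad x)) (r ^+ 2 *: x - A (Ad x)).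
  by rewrite -(fock_norm hbasis) exprn_ge0.
have r2C : (r ^+ 2)^*%R = r ^+ 2 by rewrite rmorphXn/= conj_Creal// gtr0_real.
rewrite !(brBl, brB, brZ, brZl) r2C zx xz => pos small.
rewrite -subr_ge0 -(@pmulr_rge0 _ (r ^+ 2)) ?exprn_gt0//.
move: pos small; set X := braket ip x x; set Z := braket ip (A _) _ => pos small.
have -> : r ^+ 2 * (r ^+ 2 * X - m) =
    r ^+ 2 * (r ^+ 2 * X) - r ^+ 2 * m - (r ^+ 2 * m - Z) + (r ^+ 2 * m - Z) by ring.
by rewrite addr_ge0// subr_ge0.
Qed.

Lemma linear_zero (A : H -> H) : linear A -> A 0 = 0.
Proof.
move=> linA; have := linA (-1) 0 0; rewrite scaler0 addr0 scaleN1r => e.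
by rewrite {1}e addNr.
Qed.

Lemma linear_scale (A : H -> H) (linA : linear A) a x : A (a *: x) = a *: A x.
Proof. by have := linA a x 0; rewrite (linear_zero linA) !addr0. Qed.

Let entry_real A n : (forall x, 0 <= braket ip x (A x)) ->
  entry ip ket A n n = (population ip ket A n)%:C /\ 0 <= population ip ket A n.
Proof. by move=> A0; exact: (braket_real_ge0 (A0 _)). Qed.

Lemma trace_finite (A : H -> H) (q : nat -> R) N :
  (forall n, entry ip ket A n n = (q n)%:C) -> (forall n, (N <= n)%N -> q n = 0) ->
  cvgn (series (fun n => entry ip ket A n n) : nat -> R[i]^o) /\
  trace ip ket A = (\sum_(0 <= n < N) q n)%:C.
Proof.
move=> Aq qN; rewrite /trace.
have -> : (fun n => entry ip ket A n n) = (fun n => (q n)%:C) by apply/funext.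
have z n : (N <= n)%N -> (q n)%:C = 0 :> R[i]^o by move=> /qN ->.
split; first by apply/cvg_ex; eexists; exact: (cvg_series_finsupp z).
by rewrite (lim_series_finsupp z) rmorph_sum.
Qed.

Lemma density_population nstar rho : density_upto ip ket nstar rho ->
  pmf nstar.+1 (population ip ket rho).
Proof.
move=> [rhoD rho0].
have eR n := entry_real n (density_ge0 rhoD).
have supp n : (nstar.+1 <= n)%N -> population ip ket rho n = 0.
  by move=> nn; rewrite /population /entry rho0// /braket linear0l.
split=> //; first by move=> n; case: (eR n).
have [_ tr] := trace_finite (fun n => (eR n).1) supp.
by apply: complexI; rewrite -tr (density_trace1 rhoD).
Qed.

Section Measurement.
Context (phi0 phiR theta0 : R) (M Madj : outcome -> control -> H -> H).
Hypothesis hM : measurement_operators ket phi0 phiR theta0 M.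
Hypothesis hMadj : forall y u, adjoint_of ip (M y u) (Madj y u).

Local Notation amp := (adjoint_coef phi0 phiR theta0).

(** <m|Ad|n> is the conjugate of <n|M|m>, and M |m> is a multiple of a Fock
    state. *)
Lemma adjoint_ket y u n :
  Madj y u (ket n) = (amp y u n)%:C *: ket (source y u n).
Proof.
apply: braket_inj => m; rewrite -(adjointC (hMadj y u)) brZ.
rewrite (fock_orthonormal hbasis).
have E (c : R) (j : nat) : braket ip (c%:C *: ket j) (ket n) = c%:C * (j == n)%:R.
  by rewrite brZl conjR (fock_orthonormal hbasis).
case: y; case: u => /=.
- by rewrite (meas_gm1 hM) E; have [->|_] := eqVneq m n; rewrite ?mulr0.
- by rewrite (meas_g0 hM) E; have [->|_] := eqVneq m n; rewrite ?mulr0.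
- rewrite (meas_gp1 hM) E; case: n {E} => [|n] /=; first by rewrite mulr0 sqrtr0 mulr0 sin0 mul0r.
  by rewrite eqSS; have [->|_] := eqVneq m n; rewrite ?mulr0.
- case: m => [|m]; first by rewrite (meas_em1_0 hM) /braket linear0r mulr0.
  by rewrite (meas_em1 hM)// E/= eqSS; have [->|_] := eqVneq m n; rewrite ?mulr0.
- by rewrite (meas_e0 hM) E; have [->|_] := eqVneq m n; rewrite ?mulr0.
- by rewrite (meas_ep1 hM) E; have [->|_] := eqVneq m n; rewrite ?mulr0.
Qed.

Section State.
Context (nstar : nat) (rho : H -> H).
Hypothesis hrho : density_upto ip ket nstar rho.

Let p := population ip ket rho.
Let q y u n := amp y u n ^+ 2 * p (source y u n).

Let q_supp y u n : (nstar.+2 <= n)%N -> q y u n = 0.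
Proof.
move=> nn; rewrite /q [p _](pmf_supp (density_population hrho)) ?mulr0//.
by case: y; case: u => //=; lia.
Qed.

Lemma entry_unnormalized y u n :
  entry ip ket (unnormalized M Madj y u rho) n n = (q y u n)%:C.
Proof.
have [rhoD _] := hrho; have [rhoL _] := density_bounded rhoD.
rewrite /entry /unnormalized -(hMadj y u) adjoint_ket (linear_scale rhoL) brZ brZl conjR.
have [-> _] := braket_real_ge0 (density_ge0 rhoD (ket (source y u n))).
by rewrite mulrA -!rmorphM/= -expr2.
Qed.

Lemma outcome_probE y u :
  outcome_prob ip ket M Madj y u rho = \sum_(0 <= n < nstar.+2) q y u n.
Proof.
have [_ tr] := trace_finite (entry_unnormalized y u) (@q_supp y u).
by rewrite /outcome_prob tr.
Qed.

Lemma population_post_state y u n :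
  population ip ket (post_state ip ket M Madj y u rho) n =
  (outcome_prob ip ket M Madj y u rho)^-1 * q y u n.
Proof.
rewrite /population /entry /post_state brZ.
have := entry_unnormalized y u n; rewrite /entry => ->.
by rewrite -rmorphM.
Qed.

Let q_ge0 y u n : 0 <= q y u n.
Proof. by rewrite mulr_ge0 ?sqr_ge0// (pmf_ge0 (density_population hrho)). Qed.

Lemma outcome_prob_ge0 y u : 0 <= outcome_prob ip ket M Madj y u rho.
Proof. by rewrite outcome_probE sumr_ge0. Qed.

Lemma density_post_state y u : 0 < outcome_prob ip ket M Madj y u rho ->
  density_upto ip ket nstar.+1 (post_state ip ket M Madj y u rho).
Proof.
have [rhoD rho0] := hrho; have [rhoL rhoC] := density_bounded rhoD.
have [ML MC] := meas_bounded hM y u.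
have [AL AC] := adjoint_bounded (hMadj y u) (meas_bounded hM y u).
set pr := outcome_prob ip ket M Madj y u rho => pr0.
have prV0 : 0 <= pr^-1%:C :> R[i] by rewrite ler0c invr_ge0 ltW.
have postE x : post_state ip ket M Madj y u rho x = pr^-1%:C *: M y u (rho (Madj y u x)) by [].
have post_entry n : entry ip ket (post_state ip ket M Madj y u rho) n n = (pr^-1 * q y u n)%:C.
  have := entry_unnormalized y u n; rewrite /entry postE brZ => ->.
  by rewrite [RHS]rmorphM.
have post_supp n : (nstar.+2 <= n)%N -> pr^-1 * q y u n = 0 by move=> /q_supp ->; rewrite mulr0.
have [tr_cvg trE] := trace_finite post_entry post_supp.
split; last first.
  move=> n nn; rewrite postE adjoint_ket (linear_scale rhoL) rho0; last first.
    by case: (y) (u) => -[] /=; lia.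
  by rewrite scaler0 (linear_zero ML) scaler0.
split=> //.
- split.
    move=> a x z; rewrite !postE AL rhoL ML scalerDr !scalerA; congr (_ *: _ + _).
    by rewrite mulrC.
  move=> x; apply: (@continuousZl_tmp _ _ _ (fun x => M y u (rho (Madj y u x))) pr^-1%:C).
  apply: (@continuous_comp _ _ _ (Madj y u) (fun z => M y u (rho z))).
    exact: AC.
  by apply: (@continuous_comp _ _ _ rho (M y u)); [exact: rhoC|exact: MC].
- move=> x z; rewrite !postE brZl conjR brZ; congr (_ * _).
  rewrite (adjointC (hMadj y u)) -(hMadj y u).
  exact: (density_selfadjoint rhoD).
- move=> x; rewrite postE brZ mulr_ge0// -(hMadj y u).
  exact: (density_ge0 rhoD).
- by rewrite trE -mulr_sumr -outcome_probE mulVf// gt_eqF.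
Qed.

End State.

Local Notation wt := (fock_prob phi0 phiR theta0).
Local Notation wg := (fock_prob_g phi0 phiR theta0).

Lemma outcome_prob_mixture y u nstar rho : density_upto ip ket nstar rho ->
  outcome_prob ip ket M Madj y u rho =
  \sum_(0 <= n < nstar.+1) wt y u n * population ip ket rho n.
Proof.
move=> hrho; rewrite (outcome_probE hrho).
have := @sum_source_target R phi0 phiR theta0 y u (fun _ x => x)
  (population ip ket rho) nstar.+1.
by apply=> // n; exact: (pmf_supp (density_population hrho)).
Qed.

Lemma outcome_prob_sum u rho : density_star ip ket rho ->
  outcome_prob ip ket M Madj og u rho + outcome_prob ip ket M Madj oe u rho = 1.
Proof.
move=> [nstar hrho]; rewrite !(outcome_prob_mixture _ _ hrho) -big_split/=.
rewrite -[RHS](pmf_sum (density_population hrho)); apply: eq_bigr => n _.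
by rewrite /fock_prob/=; ring.
Qed.

Lemma lyapunov_finite nbar eps rho N :
  (forall n, (N <= n)%N -> population ip ket rho n = 0) ->
  lyapunov ip ket nbar eps rho =
  \sum_(0 <= n < N) population ip ket rho n * (n%:R - nbar%:R) ^+ 2
  - eps * \sum_(0 <= n < N) population ip ket rho n ^+ 2.
Proof.
move=> pN; rewrite /lyapunov (@lim_series_finsupp R R^o _ N) ?(@lim_series_finsupp R R^o _ N)//.
  by move=> n /pN ->; rewrite expr0n.
by move=> n /pN ->; rewrite mul0r.
Qed.

(** An outcome of probability 0 fits the formula, because its unnormalized
    populations all vanish. *)
Lemma expected_term y u nstar nbar eps rho : density_upto ip ket nstar rho ->
  let p := population ip ket rho in
  outcome_prob ip ket M Madj y u rho *
    lyapunov ip ket nbar eps (post_state ip ket M Madj y u rho) =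
  \sum_(0 <= n < nstar.+1) wt y u n * p n * ((target y u n)%:R - nbar%:R) ^+ 2
  - eps * ((outcome_prob ip ket M Madj y u rho)^-1
           * \sum_(0 <= n < nstar.+1) (wt y u n * p n) ^+ 2).
Proof.
move=> hrho p.
set pr := outcome_prob ip ket M Madj y u rho.
pose q n := adjoint_coef phi0 phiR theta0 y u n ^+ 2 * p (source y u n).
have pN n : (nstar.+1 <= n)%N -> p n = 0 := @pmf_supp _ _ _ (density_population hrho) n.
have postE n : population ip ket (post_state ip ket M Madj y u rho) n = pr^-1 * q n.
  exact: (population_post_state hrho).
have q0 n : 0 <= q n by rewrite mulr_ge0 ?sqr_ge0// (pmf_ge0 (density_population hrho)).
have qN n : (nstar.+2 <= n)%N -> q n = 0.
  by move=> nn; rewrite /q pN ?mulr0//; case: (y) (u) => -[] /=; lia.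
have prE : pr = \sum_(0 <= n < nstar.+2) q n by exact: (outcome_probE hrho).
rewrite (@lyapunov_finite _ _ _ nstar.+2); last by move=> n nn; rewrite postE qN// mulr0.
under eq_bigr do rewrite postE -mulrA.
under [in X in _ - eps * X]eq_bigr do rewrite postE exprMn.
rewrite -!mulr_sumr.
have sumT (F : nat -> R -> R) : (forall k, F k 0 = 0) -> \sum_(0 <= n < nstar.+2) F n (q n) =
    \sum_(0 <= n < nstar.+1) F (target y u n) (wt y u n * p n).
  by move=> F0; exact: (@sum_source_target R phi0 phiR theta0 y u F p nstar.+1 F0 pN).
rewrite (sumT (fun n x => x * (n%:R - nbar%:R) ^+ 2)); last by move=> k; rewrite mul0r.
rewrite (sumT (fun n x => x ^+ 2)); last by move=> k; rewrite expr0n.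
rewrite mulrBr; congr (_ - _).
  have [pr0|prn0] := eqVneq pr 0; last by rewrite mulVKf.
  rewrite pr0 mul0r -(sumT (fun n x => x * (n%:R - nbar%:R) ^+ 2)); last by move=> k; rewrite mul0r.
  rewrite big1_seq// => n; rewrite mem_index_iota => /andP[_ nn].
  suff -> : q n = 0 by rewrite mul0r.
  by apply/eqP; rewrite eq_le q0 andbT -pr0 prE sum_ge_term.
have [->|prn0] := eqVneq pr 0; first by rewrite mul0r invr0 mul0r mulr0.
by field.
Qed.

(** The expected decrease of the Lyapunov function under the control u: drift of
    the squared distance to nbar, plus the convexity gain due to the
    measurement. *)
Lemma expected_gain u nstar nbar eps rho : density_upto ip ket nstar rho ->
  0 <= eps ->
  \sum_(0 <= n < nstar.+1) population ip ket rho n * ((n%:R - nbar%:R) ^+ 2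
     - wg u n * ((target og u n)%:R - nbar%:R) ^+ 2
     - (1 - wg u n) * ((target oe u n)%:R - nbar%:R) ^+ 2)
  + eps * \sum_(0 <= n < nstar.+1)
      population ip ket rho n ^+ 2 * (wg u n - outcome_prob ip ket M Madj og u rho) ^+ 2
  <= lyapunov ip ket nbar eps rho - expected_lyapunov ip ket M Madj nbar eps u rho.
Proof.
move=> hrho eps0; have pP := density_population hrho.
have peE : outcome_prob ip ket M Madj oe u rho = 1 - outcome_prob ip ket M Madj og u rho.
  by apply/eqP; rewrite eq_sym subr_eq addrC outcome_prob_sum//; exists nstar.
rewrite (lyapunov_finite _ _ (pmf_supp pP)) /expected_lyapunov.
rewrite !(expected_term _ _ _ _ hrho) peE.
apply: (measurement_gain (fun n => (n%:R - nbar%:R) ^+ 2) (target og u) (target oe u)) => //.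
- exact: fock_prob_g_bound.
- exact: outcome_prob_mixture.
Qed.

End Measurement.
End Operators.

(** * Drift towards the target level *)

(** The expected decrease of the squared distance to nbar in one step from |n>
    under the control u. *)
Definition drift (R : realType) (phi0 phiR theta0 : R) (nbar : nat) u n : R :=
  (n%:R - nbar%:R) ^+ 2
  - fock_prob_g phi0 phiR theta0 u n * ((target og u n)%:R - nbar%:R) ^+ 2
  - (1 - fock_prob_g phi0 phiR theta0 u n) * ((target oe u n)%:R - nbar%:R) ^+ 2.

Lemma drift_u0 (R : realType) (phi0 phiR theta0 : R) nbar n :
  drift phi0 phiR theta0 nbar u0 n = 0.
Proof. by rewrite /drift /=; ring. Qed.

Lemma drift_bound (R : realType) (phi0 phiR theta0 : R) nbar u n :
  `|drift phi0 phiR theta0 nbar u n| <= 2 * `|n%:R - nbar%:R| + 1.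
Proof.
have aux (w z x : R) : 0 <= w <= 1 -> `|z| <= 2 * `|x| + 1 -> `|w * z| <= 2 * `|x| + 1.
  by move=> /andP[w0 w1]; rewrite normrM ger0_norm//; apply: le_trans; rewrite ler_piMl.
case: u; last 1 first.
- have wb := fock_prob_g_bound phi0 phiR theta0 up1 n.
  have -> : drift phi0 phiR theta0 nbar up1 n = fock_prob_g phi0 phiR theta0 up1 n *
      - (2 * (n%:R - nbar%:R) + 1).
    by rewrite /drift/= -natr1; ring.
  apply: aux => //; rewrite normrN (le_trans (ler_normD _ _))// normrM normr1.
  by rewrite ger0_norm.
- case: n => [|n].
    rewrite /drift/= sqrtr0 mulr0 cos0 expr1n.
    have -> : forall a : R, a - 1 * a - (1 - 1) * a = 0 by move=> a; ring.
    by rewrite normr0 addr_ge0// mulr_ge0.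
  have wb : 0 <= 1 - fock_prob_g phi0 phiR theta0 um1 n.+1 <= 1.
    have /andP[? ?] := fock_prob_g_bound phi0 phiR theta0 um1 n.+1.
    by rewrite subr_ge0 gerBl; apply/andP.
  have -> : drift phi0 phiR theta0 nbar um1 n.+1 = (1 - fock_prob_g phi0 phiR theta0 um1 n.+1) *
      (2 * (n.+1%:R - nbar%:R) - 1).
    by rewrite /drift/= -natr1; ring.
  apply: aux => //; rewrite (le_trans (ler_normB _ _))// normrM normr1.
  by rewrite ger0_norm.
- by rewrite drift_u0 normr0 addr_ge0// mulr_ge0.
Qed.

(** Below nbar the control +1 can only raise the level, by one and with positive
    probability; above nbar, the control -1 lowers it. *)
Lemma drift_towards (R : realType) (phi0 phiR theta0 : R) nbar m :
  irrational ((theta0 / pi) ^+ 2) -> m != nbar ->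
  exists u, 0 < drift phi0 phiR theta0 nbar u m.
Proof.
move=> irr; rewrite neq_ltn => /orP[mn|nm].
- exists up1.
  have -> : drift phi0 phiR theta0 nbar up1 m = fock_prob_g phi0 phiR theta0 up1 m *
      (2 * (nbar%:R - m%:R) - 1).
    by rewrite /drift/= -natr1; ring.
  apply: mulr_gt0; first by rewrite /= exprn_even_gt0//= sin_sqrt_neq0.
  have : 1 <= nbar%:R - m%:R :> R by rewrite -natrB ?(ltnW mn)// ler1n subn_gt0.
  lra.
- exists um1; case: m nm => // m nm.
  have -> : drift phi0 phiR theta0 nbar um1 m.+1 = (1 - fock_prob_g phi0 phiR theta0 um1 m.+1) *
      (2 * (m.+1%:R - nbar%:R) - 1).
    by rewrite /drift/= -natr1; ring.
  apply: mulr_gt0; first by rewrite /= -sin2cos2 exprn_even_gt0//= sin_sqrt_neq0.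
  have : 1 <= m.+1%:R - nbar%:R :> R by rewrite -natrB ?(ltnW nm)// ler1n subn_gt0.
  lra.
Qed.

(** * Convergence of the closed loop *)

Theorem theorem2 (R : realType) (H : completeNormedModType R[i])
    (ip : {dot H for Num.conj}) (ket : nat -> H) (hbasis : fock_basis ip ket)
    (nbar : nat) (eps : R) (heps : 0 < eps)
    (phi0 phiR theta0 : R)
    (hphi0 : irrational (phi0 / pi)) (htheta0 : irrational ((theta0 / pi) ^+ 2))
    (hphiR : phiR = pi / 2 - nbar%:R * phi0)
    (M Madj : outcome -> control -> H -> H)
    (hM : measurement_operators ket phi0 phiR theta0 M)
    (hMadj : forall y u, adjoint_of ip (M y u) (Madj y u))
    (f : (H -> H) -> control)
    (hf : argmin_feedback ip ket M Madj nbar eps f)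
    (rho0 : H -> H) (hrho0 : density_star ip ket rho0)
    (d : measure_display) (T : measurableType d) (P : probability T R)
    (rho : nat -> T -> H -> H) (y : nat -> T -> outcome)
    (hproc : closed_loop_process ip ket M Madj f rho0 P rho y) :
  {ae P, forall w, forall n,
    (fun k => entry ip ket (rho k w) n n : R[i]^o) @ \oo -->
      (entry ip ket (fock_state ip ket nbar) n n : R[i]^o)}.
Proof.
pose V := lyapunov ip ket nbar eps.
pose EV := expected_lyapunov ip ket M Madj nbar eps.
pose Q x := V x - EV (f x) x.
have eps_ge0 := ltW heps.
have gain u x nstar : density_upto ip ket nstar x ->
    \sum_(0 <= n < nstar.+1) population ip ket x n * drift phi0 phiR theta0 nbar u n
    + eps * \sum_(0 <= n < nstar.+1) population ip ket x n ^+ 2 *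
        (fock_prob_g phi0 phiR theta0 u n - outcome_prob ip ket M Madj og u x) ^+ 2
    <= Q x.
  move=> hx; apply: (le_trans (expected_gain hbasis hM hMadj u nbar hx eps_ge0)).
  by rewrite lerD2l lerN2; apply: hf; exists nstar.
have variance_gain x nstar n : density_upto ip ket nstar x ->
    eps * (population ip ket x n ^+ 2 *
      (fock_prob_g phi0 phiR theta0 u0 n - outcome_prob ip ket M Madj og u0 x) ^+ 2) <= Q x.
  move=> hx; apply: le_trans (gain u0 x nstar hx).
  rewrite big1 ?add0r => [|k _]; last by rewrite drift_u0 mulr0.
  rewrite ler_wpM2l//; have pP := density_population hx.
  have [nN|Nn] := ltnP n nstar.+1.
    apply: (@sum_ge_term _ (fun k => population ip ket x k ^+ 2 * _)) => // k.
    by rewrite mulr_ge0 ?sqr_ge0.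
  rewrite (pmf_supp pP Nn) expr0n mul0r sumr_ge0// => k _.
  by rewrite mulr_ge0 ?sqr_ge0.
have drift_gain u x nstar : density_upto ip ket nstar x ->
    \sum_(0 <= n < nstar.+1) population ip ket x n * drift phi0 phiR theta0 nbar u n <= Q x.
  move=> hx; apply: le_trans (gain u x nstar hx); rewrite lerDl mulr_ge0// sumr_ge0// => n _.
  by rewrite mulr_ge0 ?sqr_ge0.
have Q_ge0 x : density_star ip ket x -> 0 <= Q x.
  move=> [nstar hx]; apply: le_trans (variance_gain x nstar 0%N hx).
  by rewrite mulr_ge0// mulr_ge0 ?sqr_ge0.
have moment_le x nstar : density_upto ip ket nstar x ->
    \sum_(0 <= n < nstar.+1) population ip ket x n * (n%:R - nbar%:R) ^+ 2 <= V x + eps.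
  move=> hx; have pP := density_population hx.
  rewrite /V (lyapunov_finite _ _ (pmf_supp pP)) -addrA lerDl addrC subr_ge0.
  rewrite ler_piMr// -[leRHS](pmf_sum pP); apply: ler_sum => n _.
  by rewrite expr2 ler_piMr ?(pmf_ge0 pP)// (pmf_le1 _ pP).
have W_ge0 x : density_star ip ket x -> 0 <= V x + eps.
  move=> [nstar hx]; apply: le_trans (moment_le x nstar hx).
  apply: sumr_ge0 => n _.
  by rewrite mulr_ge0 ?sqr_ge0// (pmf_ge0 (density_population hx)).
have chain : binary_chain (density_star ip ket)
    (fun a x => post_state ip ket M Madj a (f x) x)
    (fun a x => outcome_prob ip ket M Madj a (f x) x) P rho y.
  split.
  - by move=> a x [nstar hx]; exact: (outcome_prob_ge0 hbasis hM hMadj hx).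
  - by move=> x hx; exact: (outcome_prob_sum hbasis hM hMadj).
  - move=> a x [nstar hx] pa; exists nstar.+1.
    exact: (density_post_state hbasis hM hMadj hx).
  - exact: (state_measurable hproc).
  - exact: (outcome_measurable hproc).
  - exact: (state_next hproc).
  - exact: (outcome_law hproc).
have super : supermartingale_on (density_star ip ket)
    (fun a x => post_state ip ket M Madj a (f x) x)
    (fun a x => outcome_prob ip ket M Madj a (f x) x) (fun x => V x + eps) Q.
  split=> // x hx; have := outcome_prob_sum hbasis hM hMadj (f x) hx.
  move=> /(congr1 ( *%R^~ eps)); rewrite mul1r mulrDl /Q /EV /expected_lyapunov -/V => prE.
  by rewrite !mulrDr; lra.
apply: filterS (supermartingale_ae_bounded chain super hrho0 (state_init hproc)).
move=> w [lam bounded] m.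
have hD k : density_star ip ket (rho k w) by have [] := bounded k.
have /choice[nstar hN] : forall k, exists n, density_upto ip ket n (rho k w) by [].
have sumQ_ge0 k : 0 <= \sum_(0 <= i < k) Q (rho i w).
  by apply: sumr_ge0 => i _; exact: Q_ge0.
have Q0 : (fun k => Q (rho k w)) @ \oo --> 0.
  apply: (@bounded_sums_cvg0 _ _ lam) => k; first exact: Q_ge0.
  by have [_ /ltW] := bounded k; have := W_ge0 _ (hD k); lra.
have pop_cvg : (fun k => population ip ket (rho k w) m) @ \oo --> ((m == nbar)%:R : R).
  apply: (@populations_cvg R nbar eps lam (fock_prob_g phi0 phiR theta0 u0)
    (fun k => (nstar k).+1) (fun k => population ip ket (rho k w))
    (fun k => outcome_prob ip ket M Madj og u0 (rho k w)) (fun k => Q (rho k w))) => //.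
  - exact: phase_inj hphi0 hphiR.
  - by move=> k; exact: (density_population (hN k)).
  - by move=> k n; exact: variance_gain (hN k).
  - move=> n nn; have [u du] := drift_towards phi0 phiR htheta0 nn.
    exists (drift phi0 phiR theta0 nbar u n), (drift phi0 phiR theta0 nbar u).
    split=> // [k|k]; first exact: drift_bound.
    exact: drift_gain (hN k).
  - move=> k; apply: le_trans (moment_le _ _ (hN k)) _.
    by have [_ /ltW] := bounded k; have := sumQ_ge0 k; lra.
have -> : (fun k => entry ip ket (rho k w) m m) =
    (fun k => (population ip ket (rho k w) m)%:C).
  apply/funext => k; have [hk _] := hN k.
  by have [] := braket_real_ge0 (density_ge0 hk (ket m)).
have -> : entry ip ket (fock_state ip ket nbar) m m = ((m == nbar)%:R : R)%:C.
  have ortho := fock_orthonormal hbasis; rewrite /entry /fock_state ortho eq_sym.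
  have [->|_] := eqVneq m nbar; first by rewrite scale1r ortho eqxx.
  by rewrite scale0r /braket linear0l.
exact: cvg_real_complex.
Qed.
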